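(* Assume both of the following hypotheses. (i) There exists $C>0$ such that for every sufficiently large $p\in\mathcal{P}_3$, \[ Z(p)\le C\cdot\frac{A\bigl(2^{2p}/(4p)\bigr)}{p}. \] (ii) $A(x)=o(\log x)$ as $x\to\infty$. Then $|H_{\mathrm{even}}|<\infty$.
   Context: 3-Higgs primes are defined recursively: $2$ is 3-Higgs; an odd prime $p$ is 3-Higgs if and only if every prime factor $q$ of $p-1$ is a 3-Higgs prime (necessarily $q<p$) and satisfies $v_q(p-1)\le 3$ (including $v_2(p-1)\le 3$), where $v_q$ is the $q$-adic valuation. $\mathcal{P}_3$ is the set of 3-Higgs primes. $H$ is the set of integers $m\ge 1$ such that every prime factor of $2^m+1$ is 3-Higgs, and $H_{\mathrm{even}}=H\cap 2\mathbb{Z}$. $\mathcal{S}_3^{(\le 3)}$ is the set of integers $n\ge1$ all of whose prime factors lie in $\mathcal{P}_3$ and occur in $n$ with exponent at most $3$. $A(x):=\#\bigl(\mathcal{S}_3^{(\le3)}\cap[1,x]\bigr)$. $\Phi_n$ is the $n$-th cyclotomic polynomial, and \[ Z(p):=\#\Bigl\{r \text{ prime}: r\mid\Phi_{4p}(2),\ (r-1)/(4p)\in\mathcal{S}_3^{(\le3)}\Bigr\}. \] *)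

(* Defs.v *)
From HB Require Import structures.
From mathcomp Require Import all_boot all_order all_algebra all_field finmap.
From mathcomp Require Import all_classical all_reals all_analysis.

Set Implicit Arguments.
Unset Strict Implicit.
Unset Printing Implicit Defensive.

Import Order.TTheory GRing.Theory Num.Theory.
Import numFieldNormedType.Exports.

Local Open Scope classical_set_scope.
Local Open Scope ring_scope.

(* The recursion is well founded: a prime factor of p - 1 is smaller than p. *)
Inductive higgs3 : nat -> Prop :=
| Higgs3_two : higgs3 2
| Higgs3_odd (p : nat) :
    prime p -> odd p ->
    (forall q : nat, prime q -> (q %| p.-1)%N -> higgs3 q) ->
    (forall q : nat, prime q -> (q %| p.-1)%N -> (logn q p.-1 <= 3)%N) ->
    higgs3 p.

Definition higgs3_exponents : set nat :=
  [set m | (1 <= m)%N /\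
    forall q : nat, prime q -> (q %| 2 ^ m + 1)%N -> higgs3 q].

Definition even_higgs3_exponents : set nat :=
  higgs3_exponents `&` [set m | (2 %| m)%N].

Definition smooth3 : set nat :=
  [set n | (1 <= n)%N /\
    forall q : nat, prime q -> (q %| n)%N -> higgs3 q /\ (logn q n <= 3)%N].

Definition smooth3_upto (R : realType) (x : R) : set nat :=
  smooth3 `&` [set n | n%:R <= x].

(* [fset_set] is meaningful on finite sets only; see [finite_smooth3_upto]
   and [finite_Zset]. *)
Definition Acount (R : realType) (x : R) : nat :=
  #|` fset_set (smooth3_upto x)|%fset.

(* [%/] is truncated, so integrality of (r - 1) / (4 p) is required apart. *)
Definition Zset (p : nat) : set nat :=
  [set r | [/\ prime r,
               (r%:Z %| ('Phi_(4 * p)).[2])%Z,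
               (4 * p %| r.-1)%N &
               smooth3 (r.-1 %/ (4 * p))%N]].

Definition Zcount (p : nat) : nat := #|` fset_set (Zset p)|%fset.

(* Lets the notation [f =o_F g] accept the filter +oo. *)
Canonical pinfty_filter_on (R : numFieldType) := FilterType (pinfty_nbhs R) _.

Lemma finite_smooth3_upto (R : realType) (x : R) : finite_set (smooth3_upto x).
Proof.
apply: (@sub_finite_set _ _ `I_(Num.truncn x).+1); last exact: finite_II.
move=> n [_ nx] /=; rewrite ltnS -[X in (X <= _)%N](@natrK R).
exact: le_truncn.
Qed.

Lemma finite_Zset (p : nat) : (0 < p)%N -> finite_set (Zset p).
Proof.
move=> p0; have n0 : (0 < 4 * p)%N by rewrite muln_gt0.
have n_div : (4 * p)%N \in divisors (4 * p) by rewrite -dvdn_divisors.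
have phi0 : ('Phi_(4 * p)).[2] != 0.
  apply/eqP => phi0; have := congr1 (horner^~ 2) (prod_Cyclotomic n0).
  rewrite (perm_big _ (perm_to_rem n_div)) /= big_cons hornerM phi0 mul0r.
  rewrite !hornerE => /esym/eqP; rewrite subr_eq0 => /eqP/(congr1 absz).
  rewrite abszX => h.
  by have := ltn_expl (4 * p) (isT : (1 < 2)%N); rewrite h ltnS leqNgt n0.
apply: (@sub_finite_set _ _ `I_(`|('Phi_(4 * p)).[2]|%N).+1).
  move=> r [_ rd _ _] /=; rewrite ltnS.
  by apply: dvdn_leq; [rewrite absz_gt0|exact: rd].
exact: finite_II.
Qed.

(* Main.v *)
Require Import Defs.
From mathcomp Require Import all_boot all_order all_algebra all_field finmap.
From mathcomp Require Import all_classical all_reals all_analysis.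
From mathcomp Require Import ring zify.

Import Order.TTheory GRing.Theory Num.Theory.
Import numFieldNormedType.Exports.

Local Open Scope classical_set_scope.
Local Open Scope ring_scope.

(** The even elements [m] of [higgs3_exponents] turn out to divide a fixed
    integer [2 * B`! ^ 3].  The link between [m] and the arithmetic of [r - 1],
    for a prime [r] dividing [2 ^ m + 1], is the order of well chosen elements
    of ['F_r]: such an [r] is 3-Higgs, so no fourth power of a prime divides
    [r - 1] and every prime factor of [r - 1] is 3-Higgs.

    - If [4 %| m], then [-2] is a square modulo [r], and its square root yields
      an element of order 16, so that [16 %| r - 1]
      ([higgs3_exponents_not_dvd4]).  Hence [m] is twice an odd number.
    - If [p] is an odd prime and [p ^ j] exactly divides [m], then
      [2 ^ m + 1 = x ^ p + 1] with [x = 2 ^ (m / p)] has a prime factor [r] that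
      does not divide [x + 1] ([prime_dvd_expn_add1_new]); modulo such an [r]
      some power of 2 has order [p ^ j], so that [p ^ j %| r - 1].  Therefore
      [p] is 3-Higgs and [j <= 3] ([even_higgs3_exponents_prime_factor]).
    - With [m] twice an odd number, [2 ^ (2 * p) + 1] divides [2 ^ m + 1] for
      the same [p].  A prime factor of [4 ^ p + 1] other than 5 is then 3-Higgs
      and 2 has order [4 * p] modulo it, so it belongs to [Zset p]
      ([Zset_nonempty]).

    Only now do the two analytic hypotheses enter.  Since
    [ln (2 ^ (2 * p) / (4 * p))] is at most linear in [p], they make [Zcount p]
    at most 1/2, thus zero, for all large 3-Higgs [p] ([Zcount_eq0_near]).
    So the odd prime factors of [m] are bounded by some [B], their exponents
    are at most 3, and the exponent of 2 is 1. *)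

(** * Primes dividing x^p + 1 but not x + 1 *)

(** Second-order expansion of the geometric sum around [y = 0]: it is what
    determines, with [y = x + 1], the quotient [(x ^ p + 1) / (x + 1)] modulo
    [x + 1], and modulo [p ^ 2] when [p %| x + 1]. *)
Lemma sum_expr_oneB (y : int) (n : nat) :
  exists s : int,
    \sum_(i < n) (1 - y) ^+ i = n%:Z - y * ('C(n, 2))%:Z + y ^+ 2 * s.
Proof.
elim: n => [|n [s IHn]]; first by exists 0; rewrite big_ord0 bin0n mulr0 mulr0.
exists ('C(n, 2)%:Z + s * (1 - y)).
rewrite big_ord_recl expr0; under eq_bigr do rewrite lift0 exprS.
rewrite -mulr_sumr IHn binS bin1 -(addn1 n) !PoszD; ring.
Qed.

(** A weak form of Zsigmondy's theorem.  Let [q] be the quotient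
    [(x ^ p + 1) / (x + 1)].  It is congruent to [p] modulo [x + 1], so if all
    its prime factors divide [x + 1] then it is a power of [p]; it is congruent
    to [p] modulo [p ^ 2] when [p %| x + 1], so it is at most [p].  This is too
    small as soon as [x >= 4]; for [x = 2] and [p = 3] the conclusion fails, as
    [9 = 2 ^ 3 + 1] shows. *)
Lemma prime_dvd_expn_add1_new (p x : nat) :
  prime p -> odd p -> (4 <= x)%N ->
  exists r : nat, [/\ prime r, (r %| x ^ p + 1)%N & ~~ (r %| x + 1)%N].
Proof.
move=> p_pr p_odd x4; apply: contrapT => no_new.
have p3 : (2 < p)%N by rewrite odd_prime_gt2.
have [s defQ] := sum_expr_oneB (x + 1)%:Z p.
set Q := \sum_(i < p) _ in defQ.
pose q := `|Q|%N.
have def_q : (x ^ p + 1 = (x + 1) * q)%N.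
  have : (x + 1)%:Z * Q = (x ^ p + 1)%:Z.
    have := subrX1 (1 - (x + 1)%:Z) p; rewrite -/Q.
    have -> : 1 - (x + 1)%:Z = - x%:Z by lia.
    by rewrite exprNn -signr_odd p_odd expr1 !PoszD -rmorphXn /=; lia.
  by move=> /(congr1 absz); rewrite abszM /= => <-.
have q0 : (0 < q)%N by lia.
have dvd_q d : (d %| q)%N = (d%:Z %| Q)%Z by rewrite dvdzE.
(* Such an [r] divides both [q] and [x + 1], hence [p]. *)
have q_pnat : p.-nat q.
  apply/pnatP => // r r_pr rq; rewrite inE.
  have rx : (r %| x + 1)%N.
    apply: contrapT => /negP rx; apply: no_new; exists r; split=> //.
    by rewrite def_q dvdn_mull.
  have : (r%:Z %| p%:Z)%Z.
    have -> : p%:Z = Q + (x + 1)%:Z * ('C(p, 2)%:Z - (x + 1)%:Z * s).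
      rewrite defQ; ring.
    by rewrite rpredD -?dvd_q ?dvdz_mulr ?dvdzE.
  by rewrite dvdzE /= dvdn_prime2.
have p_bin : (p %| 'C(p, 2))%N by rewrite prime_dvd_bin.
have log_q : (logn p q <= 1)%N.
  rewrite leqNgt -pfactor_dvdn //; apply/negP => p2q.
  have px : (p %| x + 1)%N.
    apply: contrapT => /negP px; apply: no_new; exists p; split=> //.
    by rewrite def_q dvdn_mull // (dvdn_trans _ p2q) // dvdn_exp.
  have : ((p ^ 2)%N%:Z %| p%:Z)%Z.
    have -> : p%:Z = Q + (((x + 1) * 'C(p, 2))%N%:Z - ((x + 1) ^ 2)%N%:Z * s).
      rewrite defQ PoszM -rmorphXn /=; ring.
    rewrite rpredD -?dvd_q // rpredB ?dvdzE //.
      by rewrite /= expnS expn1 dvdn_mul.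
    by rewrite abszM dvdn_mulr //= dvdn_exp2r.
  rewrite dvdzE gtnNdvd ?prime_gt0 //=.
  by rewrite -{1}(expn1 p) ltn_exp2l // prime_gt1.
have q_le : (q <= p)%N.
  rewrite -[q](part_pnat_id q_pnat) p_part -[leqRHS]expn1.
  by rewrite leq_pexp2l // prime_gt0.
(* [4 ^ (p - 1) = 2 ^ (p - 1) * 2 ^ (p - 1) >= p * 2] *)
have pow_le : (p * 2 <= x ^ p.-1)%N.
  have : (4 ^ p.-1 <= x ^ p.-1)%N by rewrite leq_exp2r //; lia.
  apply: leq_trans; rewrite -[4%N]/(2 * 2)%N expnMn leq_mul //.
    by have := ltn_expl p.-1 (isT : (1 < 2)%N); lia.
  by rewrite -[leqLHS]expn1 leq_exp2l //; lia.
have : (x * (p * 2) <= x ^ p)%N.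
  by rewrite -(prednK (prime_gt0 p_pr)) expnS leq_mul // prednK ?prime_gt0.
have : ((x + 1) * q <= (x + 1) * p)%N by rewrite leq_mul.
move: def_q p3 x4; clear; nia.
Qed.

(** * Orders of elements modulo r *)

(** The hypotheses say that [w] has order exactly [l ^ j.+1], because the proper
    divisors of [l ^ j.+1] are the divisors of [l ^ j]; the order divides
    [r.-1] by Fermat's little theorem. *)
Lemma pfactor_dvd_pred_of_order (r l j : nat) (w : 'F_r) :
  prime r -> prime l -> w ^+ (l ^ j.+1) = 1 -> w ^+ (l ^ j) != 1 ->
  (l ^ j.+1 %| r.-1)%N.
Proof.
move=> r_pr l_pr w1 wN1.
have l_gt0 k : (0 < l ^ k)%N by rewrite expn_gt0 prime_gt0.
have [d d_prim /(dvdn_pfactor _ _ l_pr) [i i_le def_d]] :=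
  prim_order_exists (l_gt0 _) w1.
have -> : (l ^ j.+1)%N = d.
  rewrite def_d; congr (l ^ _)%N; apply/eqP; rewrite eqn_leq i_le andbT ltnNge.
  apply: contra wN1 => i_le_j.
  by rewrite -(prim_order_dvd d_prim) def_d dvdn_exp2l.
have w0 : w != 0.
  apply: contra_eq_neq w1 => ->.
  by rewrite expr0n gtn_eqF // eq_sym oner_eq0.
rewrite (prim_order_dvd d_prim) -(inj_eq (mulfI w0)) -exprS mulr1.
by have := expf_card w; rewrite card_Fp // prednK ?prime_gt0 // => ->.
Qed.

Lemma dvdn_expn_add1_Fp (r x n : nat) :
  prime r -> (r %| x ^ n + 1)%N = ((x%:R : 'F_r) ^+ n == -1).
Proof.
move=> r_pr; rewrite (dvdn_pcharf (pchar_Fp r_pr)) natrD natrX.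
by rewrite addr_eq0.
Qed.

Lemma oneN1_Fp (r : nat) : prime r -> odd r -> (1 : 'F_r) != -1.
Proof.
move=> r_pr r_odd; rewrite -addr_eq0 -(natrD _ 1 1) -(dvdn_pcharf (pchar_Fp r_pr)).
by rewrite dvdn_prime2 //; apply: contraTneq r_odd => ->.
Qed.

Lemma odd_dvd_pow2_add1 (r m : nat) :
  (0 < m)%N -> (r %| 2 ^ m + 1)%N -> odd r.
Proof.
move=> m0 r_dvd; apply: (dvdn_odd r_dvd).
by rewrite addn1 /= oddX; case: m m0 {r_dvd}.
Qed.

Lemma dvdn4_pred (r n : nat) :
  prime r -> (0 < n)%N -> (r %| 2 ^ (2 * n) + 1)%N -> (4 %| r.-1)%N.
Proof.
move=> r_pr n0 r_dvd.
have r_odd : odd r by apply: odd_dvd_pow2_add1 r_dvd; rewrite muln_gt0.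
move: r_dvd; rewrite dvdn_expn_add1_Fp // mulnC exprM => /eqP sqN1.
apply: (@pfactor_dvd_pred_of_order r 2 1 (2%:R ^+ n)) => //.
  by rewrite (exprM _ 2 2) sqN1 sqrrN expr1n.
by rewrite sqN1 eq_sym oneN1_Fp.
Qed.

(** With [u = 2 ^ n] one has [u ^ 4 = -1], so [u] has order 8 and [u + u ^ 3]
    is a square root of [-2], just as [zeta + zeta ^ 3] is for a primitive
    eighth root of unity.  Extracting this root gains one factor 2 in the
    order. *)
Lemma dvdn16_pred (r n : nat) :
  prime r -> (0 < n)%N -> (r %| 2 ^ (4 * n) + 1)%N -> (16 %| r.-1)%N.
Proof.
move=> r_pr n0 r_dvd.
have r_odd : odd r by apply: odd_dvd_pow2_add1 r_dvd; rewrite muln_gt0.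
move: r_dvd; rewrite dvdn_expn_add1_Fp // mulnC exprM => /eqP u4.
set u : 'F_r := _ ^+ n in u4.
pose w := u * (1 + u ^+ 2).
have w2 : w ^+ 2 = - 2%:R.
  have -> : w ^+ 2 = 2%:R * u ^+ 4 + u ^+ 2 * (1 + u ^+ 4).
    rewrite /w; ring.
  by rewrite u4 subrr mulr0 addr0 mulrN1.
(* [w ^ (8 n) = (-2) ^ (4 n) = 2 ^ (4 n) = u ^ 4 = -1]: [w ^ n] has order 16. *)
have wN1 : (w ^+ n) ^+ 8 = -1.
  rewrite -exprM mulnC (exprM w 8 n) (exprM w 2 4) w2 exprNn.
  have -> : (-1) ^+ 4 * 2%:R ^+ 4 = 2%:R ^+ 4 :> 'F_r by ring.
  by rewrite -exprM mulnC exprM -/u.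
apply: (@pfactor_dvd_pred_of_order r 2 3 (w ^+ n)) => //.
  by rewrite (exprM _ 8 2) wN1 sqrrN expr1n.
by rewrite wN1 eq_sym oneN1_Fp.
Qed.

(** The element of order [p ^ j.+1] is [w = 2 ^ (2 * n)].  With
    [x = 2 ^ (p ^ j * n)] one has [w ^ (p ^ j) = x ^ 2]; here [x] is not [-1] by
    assumption, and it is not 1 because [x ^ p = -1]. *)
Lemma pfactor_dvd_pred_new (r p j n : nat) :
  prime r -> prime p -> (0 < n)%N ->
  (r %| 2 ^ (p ^ j.+1 * n) + 1)%N -> ~~ (r %| 2 ^ (p ^ j * n) + 1)%N ->
  (p ^ j.+1 %| r.-1)%N.
Proof.
move=> r_pr p_pr n0 r_dvd r_ndvd.
have r_odd : odd r.
  by apply: odd_dvd_pow2_add1 r_dvd; rewrite muln_gt0 expn_gt0 prime_gt0.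
move: r_dvd r_ndvd; rewrite !dvdn_expn_add1_Fp // => /eqP xp xN1.
have pow2 k : ((2%:R : 'F_r) ^+ (2 * n)) ^+ k = (2%:R ^+ (k * n)) ^+ 2.
  by rewrite -!exprM; congr (_ ^+ _); lia.
apply: (@pfactor_dvd_pred_of_order r p j (2%:R ^+ (2 * n))) => //.
  by rewrite pow2 xp sqrrN expr1n.
rewrite pow2 -subr_eq0 subr_sqr_1 mulf_eq0 negb_or subr_eq0 addr_eq0 xN1 andbT.
apply: contra_eq_neq xp => x1.
by rewrite expnS -mulnA mulnC exprM x1 expr1n oneN1_Fp.
Qed.

(** * Divisibility of cyclotomic values *)

(** [a ^ n - 1] is the product of the ['Phi_d.[a]] for [d %| n], and ['Phi_d.[a]]
    divides [a ^ d - 1]: a prime factor that is new at [n] can only come from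
    the term [d = n]. *)
Lemma dvd_Cyclotomic_horner (r n : nat) (a : int) :
  (0 < n)%N -> prime r -> (r%:Z %| a ^+ n - 1)%Z ->
  (forall d, (d %| n)%N -> (d < n)%N -> ~~ (r%:Z %| a ^+ d - 1)%Z) ->
  (r%:Z %| ('Phi_n).[a])%Z.
Proof.
move=> n0 r_pr r_dvd r_new.
have phi_dvd d : (0 < d)%N -> (('Phi_d).[a] %| a ^+ d - 1)%Z.
  move=> d0; have := congr1 (horner^~ a) (prod_Cyclotomic d0).
  have dd : d \in divisors d by rewrite -dvdn_divisors.
  rewrite (perm_big _ (perm_to_rem dd)) /= big_cons hornerM !hornerE => <-.
  exact: dvdz_mulr.
move: r_dvd; have := congr1 (horner^~ a) (prod_Cyclotomic n0).
rewrite horner_prod !hornerE => <-.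
rewrite dvdzE (big_morph absz abszM (erefl _)) Euclid_dvd_prod // big_has.
move=> /hasP[d]; rewrite -dvdn_divisors // => dn rd.
have d0 : (0 < d)%N by apply: dvdn_gt0 dn.
have := dvdn_leq n0 dn; rewrite leq_eqVlt => /predU1P[<- //|d_lt].
by have := r_new d dn d_lt; rewrite (dvdz_trans _ (phi_dvd d d0)).
Qed.

Lemma dvd_pow2_sub1_Fp (r n : nat) :
  prime r -> (r%:Z %| 2 ^+ n - 1)%Z = ((2%:R : 'F_r) ^+ n == 1).
Proof.
move=> r_pr; rewrite (dvdz_pcharf (pchar_Fp r_pr)) rmorphB rmorphXn /=.
by rewrite subr_eq0 rmorph1.
Qed.

Lemma proper_dvdn_mul4 (p d : nat) :
  prime p -> (d %| 4 * p)%N -> (d < 4 * p)%N -> (d %| 2 * p)%N || (d %| 4)%N.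
Proof.
move=> p_pr d_dvd d_lt.
have [/dvdnP[e def_d]|p_d] := boolP (p %| d)%N; last first.
  move: d_dvd; rewrite Gauss_dvdl; first by move->; rewrite orbT.
  by rewrite coprime_sym prime_coprime.
move: d_dvd d_lt; rewrite def_d dvdn_pmul2r ?ltn_pmul2r ?prime_gt0 //.
by rewrite dvdn_pmul2r ?prime_gt0 //; case: e {def_d} => [|[|[|[|e]]]].
Qed.

(** Modulo [r] the order of 2 is [4 * p]: it divides [4 * p] since
    [2 ^ (2 * p) = -1], and otherwise it would divide [2 * p] or 4, which is
    excluded by [2 ^ (2 * p) = -1] in the first case, and by [4 <> -1] together
    with [4 ^ p = -1] in the second. *)
Lemma dvd_Phi4p (r p : nat) :
  prime r -> prime p -> odd r ->
  (r %| 4 ^ p + 1)%N -> ~~ (r %| 4 + 1)%N ->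
  (r%:Z %| ('Phi_(4 * p)).[2])%Z.
Proof.
move=> r_pr p_pr r_odd.
rewrite -{2}(expn1 4) !dvdn_expn_add1_Fp // expr1 => /eqP y_p y_1.
have def_y : (4%:R : 'F_r) = 2%:R ^+ 2 by rewrite -natrX.
have two_2p : (2%:R : 'F_r) ^+ (2 * p) = -1 by rewrite exprM -def_y.
have N1 := oneN1_Fp r r_pr r_odd.
apply: dvd_Cyclotomic_horner => //.
- by rewrite muln_gt0 (prime_gt0 p_pr).
- rewrite dvd_pow2_sub1_Fp // -[4%N]/(2 * 2)%N -mulnA mulnC exprM two_2p.
  by rewrite sqrrN expr1n.
move=> d d_dvd d_lt; rewrite dvd_pow2_sub1_Fp //; apply/negP => /eqP d1.
case/orP: (proper_dvdn_mul4 p d p_pr d_dvd d_lt) => /dvdnP[e def_e].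
  by move: N1; rewrite -two_2p def_e mulnC exprM d1 expr1n eqxx.
have : (4%:R : 'F_r) ^+ 2 == 1.
  by rewrite def_y -exprM -[(2 * 2)%N]/4%N def_e mulnC exprM d1 expr1n.
rewrite sqrf_eq1 (negPf y_1) orbF => /eqP y1.
by move: N1; rewrite -y_p y1 expr1n eqxx.
Qed.

(** * Constraints on the even exponents *)

Lemma smooth3_pred (r : nat) : higgs3 r -> odd r -> smooth3 r.-1.
Proof.
case=> // p p_pr _ p_higgs p_log _; split; first by have := prime_gt1 p_pr; lia.
by move=> q q_pr q_dvd; split; [apply: p_higgs|apply: p_log].
Qed.

Lemma smooth3_dvdn (d n : nat) : (d %| n)%N -> smooth3 n -> smooth3 d.
Proof.
move=> dn [n0 n_smooth]; split; first exact: dvdn_gt0 dn.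
move=> q q_pr qd; have [q_higgs q_log] := n_smooth q q_pr (dvdn_trans qd dn).
by split=> //; apply: leq_trans q_log; apply: dvdn_leq_log.
Qed.

(** Any prime factor [r] of [2 ^ m + 1] gives the contradiction, since
    [2 ^ 4 %| r.-1] forbids [r] to be 3-Higgs. *)
Lemma higgs3_exponents_not_dvd4 (m : nat) :
  higgs3_exponents m -> ~~ (4 %| m)%N.
Proof.
move=> [m1 m_higgs]; apply/negP => /dvdnP[n def_m].
have n0 : (0 < n)%N by lia.
have r_pr : prime (pdiv (2 ^ m + 1)).
  by rewrite pdiv_prime // addn1 ltnS expn_gt0.
have r_dvd := pdiv_dvd (2 ^ m + 1); move: (pdiv _) r_pr r_dvd => r r_pr r_dvd.
have [r1 r_smooth] :=
  smooth3_pred r (m_higgs r r_pr r_dvd) (odd_dvd_pow2_add1 r m m1 r_dvd).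
have r16 : (2 ^ 4 %| r.-1)%N.
  by apply: (dvdn16_pred r n) => //; rewrite mulnC -def_m.
have [_ log_le] := r_smooth 2%N isT (dvdn_trans (isT : (2 %| 2 ^ 4)%N) r16).
by move: r16; rewrite pfactor_dvdn // ltnNge log_le.
Qed.

(** The evenness of [m] is what guarantees [2 ^ (m / p) >= 4], as required for a
    new prime factor to exist. *)
Lemma even_higgs3_exponents_prime_factor (m p : nat) :
  even_higgs3_exponents m -> prime p -> odd p -> (p %| m)%N ->
  higgs3 p /\ (logn p m <= 3)%N.
Proof.
move=> [[m1 m_higgs] /dvdnP[n def_m]] p_pr p_odd p_dvd.
have log_gt0 : (0 < logn p m)%N by rewrite -pfactor_dvdn // expn1.
case def_j : (logn p m) log_gt0 => [//|j] _.
have /dvdnP[k def_k] : (p ^ j.+1 %| m)%N by rewrite pfactor_dvdn // def_j.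
have k0 : (0 < k)%N by case: k def_k => // def_k; lia.
have pj0 : (0 < p ^ j)%N by rewrite expn_gt0 prime_gt0.
have x4 : (4 <= 2 ^ (p ^ j * k))%N.
  rewrite -[4%N]/(2 ^ 2)%N leq_exp2l // dvdn_leq ?muln_gt0 ?pj0 //.
  have : (2 %| p * (p ^ j * k))%N.
    by rewrite mulnA -expnS mulnC -def_k def_m dvdn_mull.
  by rewrite Gauss_dvdr // coprime2n.
have [r [r_pr r_dvd r_ndvd]] := prime_dvd_expn_add1_new p _ p_pr p_odd x4.
have def_mp : (p ^ j.+1 * k = p ^ j * k * p)%N by rewrite expnS; lia.
have r_dvd' : (r %| 2 ^ (p ^ j.+1 * k) + 1)%N by rewrite def_mp expnM.
have r_dvd_m : (r %| 2 ^ m + 1)%N by rewrite def_k mulnC.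
have pj_dvd := pfactor_dvd_pred_new r p j k r_pr p_pr k0 r_dvd' r_ndvd.
have [r1 r_smooth] := smooth3_pred r (m_higgs r r_pr r_dvd_m)
  (odd_dvd_pow2_add1 r m m1 r_dvd_m).
have [p_higgs log_le] := r_smooth p p_pr
  (dvdn_trans (dvdn_exp (ltn0Sn j) (dvdnn p)) pj_dvd).
by split=> //; apply: leq_trans log_le; rewrite -pfactor_dvdn.
Qed.

(** The witness is a prime factor of [4 ^ p + 1] other than 5: it divides
    [2 ^ m + 1] because [m] is an odd multiple of [2 * p], so it is 3-Higgs. *)
Lemma Zset_nonempty (m p : nat) :
  even_higgs3_exponents m -> prime p -> odd p -> (p %| m)%N ->
  Zset p !=set0.
Proof.
move=> [m_H m_even] p_pr p_odd p_dvd; have [m1 m_higgs] := m_H.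
have p0 := prime_gt0 p_pr.
have /dvdnP[k def_m] : (2 * p %| m)%N by rewrite Gauss_dvd ?coprime2n // m_even.
have k_odd : odd k.
  have := higgs3_exponents_not_dvd4 m m_H.
  rewrite def_m -[4%N]/(2 * 2)%N mulnCA dvdn_pmul2l // Gauss_dvdl.
    by rewrite dvdn2 negbK.
  by rewrite coprime2n.
have [r [r_pr r_dvd r_ndvd]] := prime_dvd_expn_add1_new p 4 p_pr p_odd isT.
have r_dvd2 : (r %| 2 ^ (2 * p) + 1)%N by rewrite expnM.
have r_dvd_m : (r %| 2 ^ m + 1)%N.
  move: r_dvd2; rewrite !dvdn_expn_add1_Fp // => /eqP two_2p.
  by rewrite def_m mulnC exprM two_2p -signr_odd k_odd.
have r_odd := odd_dvd_pow2_add1 r m m1 r_dvd_m.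
have r_smooth := smooth3_pred r (m_higgs r r_pr r_dvd_m) r_odd.
have dvd4p : (4 * p %| r.-1)%N.
  rewrite Gauss_dvd ?(coprimeXl 2 (_ : coprime 2 p)) ?coprime2n //.
  rewrite (dvdn4_pred r p) //=; apply: (pfactor_dvd_pred_new r p 0 2) => //.
  by rewrite expn1 mulnC.
exists r; split=> //; first exact: dvd_Phi4p.
apply: smooth3_dvdn r_smooth; apply/dvdnP.
by exists (4 * p)%N; rewrite mulnC divnK.
Qed.

(** * Vanishing of Zcount at large 3-Higgs primes *)

Lemma Zcount_gt0 (p : nat) : (0 < p)%N -> Zset p !=set0 -> (0 < Zcount p)%N.
Proof.
move=> p0 [r r_Z]; rewrite /Zcount lt0n cardfs_eq0; apply/eqP => Z0.
by move: r_Z; rewrite (fset_set_set0 (finite_Zset p0) Z0).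
Qed.

Lemma pow2_div_cvgy (R : realType) :
  (2 ^+ (2 * p) / (4 * p)%:R : R) @[p --> \oo] --> +oo_R.
Proof.
apply/cvgryPge => A; near=> p.
have p0 : (0 < p)%N by near: p; exact: nbhs_infty_gt.
have pA : 4 * A <= p%:R by near: p; exact: nbhs_infty_ger.
rewrite ler_pdivlMr ?ltr0n ?muln_gt0 //.
(* [p ^ 2 <= 4 ^ p] bounds the quotient below by [p / 4]. *)
have p2 : (p * p <= 2 ^ (2 * p))%N.
  by rewrite (mulnC 2) expnM expnS expn1 leq_mul // ltnW // ltn_expl.
have : (p * p)%:R <= (2 ^ (2 * p))%:R :> R by rewrite ler_nat.
rewrite natrX; apply: le_trans; rewrite !natrM mulrA [A * _]mulrC.
by rewrite ler_wpM2r.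
Unshelve. all: end_near.
Qed.

(** Along [x = 2 ^ (2 * p) / (4 * p)], which tends to infinity, a bound
    [o(ln x)] is a bound [o(p)] because [ln x <= 2 * p * ln 2 <= 4 * p]. *)
Lemma Acount_o_exponent (R : realType) (e : R) : 0 < e ->
  (fun x : R => (Acount x)%:R : R) =o_ (+oo_R) (@ln R) ->
  \forall p \near \oo,
    (Acount (2 ^+ (2 * p) / (4 * p)%:R : R))%:R <= e * p%:R.
Proof.
move=> e0 /eqoP Asmall.
have e4 : 0 < e / 4 by rewrite divr_gt0.
pose X p : R := 2 ^+ (2 * p) / (4 * p)%:R.
have small : \forall p \near \oo, `|(Acount (X p))%:R : R| <= e / 4 * `|ln (X p)|.
  exact: pow2_div_cvgy R _ (Asmall _ e4).
have large : \forall p \near \oo, 1 <= X p.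
  by move/cvgryPge: (pow2_div_cvgy R); apply.
near=> p.
have p0 : (0 < p)%N by near: p; exact: nbhs_infty_gt.
have X1 : 1 <= X p by near: p.
have : `|(Acount (X p))%:R : R| <= e / 4 * `|ln (X p)| by near: p.
rewrite ger0_norm ?ler0n // ger0_norm ?ln_ge0 // => /le_trans; apply.
have lnX : ln (X p) <= 4 * p%:R.
  have X0 : 0 < X p by apply: lt_le_trans X1.
  have -> : 4 * p%:R = 2 *+ (2 * p) :> R.
    by rewrite -[RHS]mulr_natr natrM; ring.
  apply: (@le_trans _ _ (ln (2 ^+ (2 * p)))).
    rewrite ler_ln ?posrE ?exprn_gt0 // ler_pdivrMr ?ltr0n ?muln_gt0 //.
    by rewrite ler_peMr ?exprn_ge0 // ler1n muln_gt0.
  by rewrite lnXn // ler_wMn2r // ltW // ln_sublinear.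
have -> : e * p%:R = e / 4 * (4 * p%:R) by field.
by rewrite ler_wpM2l // ltW.
Unshelve. all: end_near.
Qed.

(** The hypotheses bound the integer [Zcount p] by a quantity tending to 0; the
    constant [(2 * C)^-1] makes it at most 1/2. *)
Lemma Zcount_eq0_near (R : realType) :
  (exists C : R, 0 < C /\
     \forall p \near \oo, higgs3 p ->
       (Zcount p)%:R <= C * ((Acount (2 ^+ (2 * p) / (4 * p)%:R : R))%:R / p%:R)) ->
  (fun x : R => (Acount x)%:R : R) =o_ (+oo_R) (@ln R) ->
  \forall p \near \oo, higgs3 p -> Zcount p = 0%N.
Proof.
move=> [C [C0 Zbound]] Asmall.
have e0 : 0 < (2 * C)^-1 by rewrite invr_gt0 mulr_gt0.
pose X p : R := 2 ^+ (2 * p) / (4 * p)%:R.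
have Abound : \forall p \near \oo, (Acount (X p))%:R <= (2 * C)^-1 * p%:R.
  exact: Acount_o_exponent R _ e0 Asmall.
have {}Zbound : \forall p \near \oo, higgs3 p ->
    (Zcount p)%:R <= C * ((Acount (X p))%:R / p%:R).
  exact: Zbound.
near=> p => p_higgs.
have p0 : (0 < p)%N by near: p; exact: nbhs_infty_gt.
have Ap : (Acount (X p))%:R <= (2 * C)^-1 * p%:R by near: p.
have Zp : (Zcount p)%:R <= C * ((Acount (X p))%:R / p%:R).
  by move: p_higgs; near: p.
have : (Zcount p)%:R <= C * (2 * C)^-1.
  by apply: le_trans Zp _; rewrite ler_pM2l // ler_pdivrMr ?ltr0n.
have -> : C * (2 * C)^-1 = 2^-1 by field; rewrite gt_eqF.
move=> Zle; apply/eqP; rewrite -leqn0 -ltnS -(ltr_nat R).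
by apply: le_lt_trans Zle _; rewrite invf_lt1 // ltr1n.
Unshelve. all: end_near.
Qed.

(** * Finiteness *)

Theorem theorem28 (R : realType)
  (Zbound : exists C : R, 0 < C /\
     \forall p \near \oo, higgs3 p ->
       (Zcount p)%:R <= C * ((Acount (2 ^+ (2 * p) / (4 * p)%:R : R))%:R / p%:R))
  (Asmall : (fun x : R => (Acount x)%:R : R) =o_ (+oo_R) (@ln R)) :
  finite_set even_higgs3_exponents.
Proof.
have [B _ Z0] := Zcount_eq0_near R Zbound Asmall.
apply: (@sub_finite_set _ _ `I_(2 * B`! ^ 3).+1); last exact: finite_II.
move=> m m_H /=; rewrite ltnS dvdn_leq ?muln_gt0 ?expn_gt0 ?fact_gt0 //.
have [m_exp _] := m_H; have [m1 _] := m_exp.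
apply/dvdn_partP => // p; rewrite mem_primes => /and3P[p_pr _ p_dvd].
rewrite p_part.
have [p_odd|p_even] := boolP (odd p); last first.
  have -> : p = 2%N by case: (even_prime p_pr) => // p_odd; rewrite p_odd in p_even.
  apply: dvdn_mulr; rewrite (dvdn_exp2l 2 (_ : _ <= 1)%N) //.
  by rewrite leqNgt -pfactor_dvdn // higgs3_exponents_not_dvd4.
have [p_higgs log_le] := even_higgs3_exponents_prime_factor m p m_H p_pr p_odd p_dvd.
apply: dvdn_mull; apply: dvdn_trans (dvdn_exp2l p log_le) _.
apply: dvdn_exp2r; apply: dvdn_fact; rewrite prime_gt0 //= leqNgt.
apply/negP => /ltnW B_le.
have := Zcount_gt0 p (prime_gt0 p_pr) (Zset_nonempty m p m_H p_pr p_odd p_dvd).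
by rewrite (Z0 p B_le p_higgs).
Qed.
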